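(* Let $R$ be a graded semi-uniform ring (graded by a group $G$). Then every graded multiplication faithful $R$-module is graded semi-uniform.
   Context: $G$ is a group; a ring $R$ with unity is $G$-graded if $R=\bigoplus_{g\in G}R_g$ for additive subgroups with $R_gR_h\subseteq R_{gh}$; a left $R$-module $M$ is graded if $M=\bigoplus_{g\in G}M_g$ for additive subgroups with $R_gM_h\subseteq M_{gh}$. $h(R)=\bigcup_g R_g$, $h(M)=\bigcup_g M_g$. An ideal $I$ of $R$ is graded if $I=\bigoplus_g(I\cap R_g)$; a submodule $N$ of $M$ is graded if $N=\bigoplus_{g}(N\cap M_g)$. $(N:_RM)=\{r\in R: rM\subseteq N\}$, which is a graded ideal if $N$ is a graded submodule. $M$ is faithful if $\{r\in R: rM=0\}=\{0\}$. $M$ is graded multiplication if every graded submodule $N$ of $M$ has the form $N=IM$ for some graded ideal $I$ of $R$ (one may then take $I=(N:_RM)$). A proper graded ideal $B$ of $R$ is graded prime if $a,b\in h(R)$, $ab\in B$ implies $a\in B$ or $b\in B$. A proper graded submodule $P$ of $M$ is graded prime if whenever $r\in h(R)$, $m\in h(M)$ and $rm\in P$, then $m\in P$ or $r\in(P:_RM)$. A nonzero graded ideal $I$ of $R$ is graded semi-essential if $I\cap B\neq\{0\}$ for every nonzero graded prime ideal $B$ of $R$. A nonzero graded submodule $K$ of $M$ is graded semi-essential if $K\cap P\neq\{0\}$ for every nonzero graded prime submodule $P$ of $M$. A nonzero graded ring $R$ is graded semi-uniform if every nonzero graded ideal of $R$ is graded semi-essential. A nonzero graded $R$-module $M$ is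 graded semi-uniform if every nonzero graded submodule of $M$ is graded semi-essential. *)

(* Defs.v *)
From HB Require Import structures.
From mathcomp Require Import all_boot all_order all_algebra.
From mathcomp Require Import all_classical.

Set Implicit Arguments.
Unset Strict Implicit.
Unset Printing Implicit Defensive.

Import GRing.Theory.

Local Open Scope classical_set_scope.
Local Open Scope ring_scope.

(* [c] is a family of components of [x] along [A]. The support has to be
   required finite: a [\sum_(g \in _)] with infinite support is 0. *)
Definition components (G : choiceType) (V : zmodType) (A : G -> set V)
    (x : V) (c : G -> V) : Prop :=
  [/\ finite_set [set g | c g <> 0],
      forall g, A g (c g) &
      x = \sum_(g \in [set: G]) c g].

Definition direct_sum (G : choiceType) (V : zmodType) (N : set V)
    (A : G -> set V) : Prop :=
  N = [set x | exists c, components A x c] /\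
  (forall x c c', components A x c -> components A x c' -> c =1 c').

Definition graded_ring (G : groupType) (R : pzRingType) (Rg : G -> set R) :
    Prop :=
  [/\ forall g, zmod_closed (mem (Rg g)),
      direct_sum [set: R] Rg &
      forall g h a b, Rg g a -> Rg h b -> Rg (g * h)%g (a * b)].

Definition graded_module (G : groupType) (R : pzRingType) (Rg : G -> set R)
    (M : lmodType R) (Mg : G -> set M) : Prop :=
  [/\ forall g, zmod_closed (mem (Mg g)),
      direct_sum [set: M] Mg &
      forall g h a m, Rg g a -> Mg h m -> Mg (g * h)%g (a *: m)].

Definition homogeneous (G : groupType) (V : zmodType) (A : G -> set V) :
  set V := \bigcup_(g in [set: G]) A g.

(* R need not be commutative; ideals are two-sided. *)
Definition ideal (R : pzRingType) (I : set R) : Prop :=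
  zmod_closed (mem I) /\ (forall a x, I x -> I (a * x) /\ I (x * a)).

Definition graded_ideal (G : groupType) (R : pzRingType) (Rg : G -> set R)
    (I : set R) : Prop :=
  ideal I /\ direct_sum I (fun g => I `&` Rg g).

Definition graded_submodule (G : groupType) (R : pzRingType) (M : lmodType R)
    (Mg : G -> set M) (N : set M) : Prop :=
  submod_closed (mem N) /\ direct_sum N (fun g => N `&` Mg g).

(* (N :_R M) *)
Definition colon (R : pzRingType) (M : lmodType R) (N : set M) : set R :=
  [set r | forall m : M, N (r *: m)].

Definition faithful (R : pzRingType) (M : lmodType R) : Prop :=
  [set r : R | forall m : M, r *: m = 0] = [set 0].

(* I M *)
Definition ideal_smul (R : pzRingType) (M : lmodType R) (I : set R) : set M :=
  [set x | exists n (r : 'I_n -> R) (m : 'I_n -> M),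
     (forall i, I (r i)) /\ x = \sum_(i < n) r i *: m i].

Definition graded_multiplication (G : groupType) (R : pzRingType)
    (Rg : G -> set R) (M : lmodType R) (Mg : G -> set M) : Prop :=
  forall N : set M, graded_submodule Mg N ->
    exists I : set R, graded_ideal Rg I /\ N = ideal_smul I.

Definition graded_prime_ideal (G : groupType) (R : pzRingType)
    (Rg : G -> set R) (B : set R) : Prop :=
  [/\ graded_ideal Rg B,
      B <> [set: R] &
      forall a b, homogeneous Rg a -> homogeneous Rg b ->
        B (a * b) -> B a \/ B b].

Definition graded_prime_submodule (G : groupType) (R : pzRingType)
    (Rg : G -> set R) (M : lmodType R) (Mg : G -> set M) (P : set M) : Prop :=
  [/\ graded_submodule Mg P,
      P <> [set: M] &
      forall r m, homogeneous Rg r -> homogeneous Mg m ->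
        P (r *: m) -> P m \/ colon P r].

Definition graded_semi_essential_ideal (G : groupType) (R : pzRingType)
    (Rg : G -> set R) (I : set R) : Prop :=
  [/\ graded_ideal Rg I,
      I <> [set 0] &
      forall B : set R, graded_prime_ideal Rg B -> B <> [set 0] ->
        I `&` B <> [set 0]].

Definition graded_semi_essential_submodule (G : groupType) (R : pzRingType)
    (Rg : G -> set R) (M : lmodType R) (Mg : G -> set M) (K : set M) : Prop :=
  [/\ graded_submodule Mg K,
      K <> [set 0] &
      forall P : set M, graded_prime_submodule Rg Mg P -> P <> [set 0] ->
        K `&` P <> [set 0]].

Definition graded_semi_uniform_ring (G : groupType) (R : pzRingType)
    (Rg : G -> set R) : Prop :=
  [set: R] <> [set 0] /\
  (forall I : set R, graded_ideal Rg I -> I <> [set 0] ->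
    graded_semi_essential_ideal Rg I).

Definition graded_semi_uniform_module (G : groupType) (R : pzRingType)
    (Rg : G -> set R) (M : lmodType R) (Mg : G -> set M) : Prop :=
  [set: M] <> [set 0] /\
  (forall K : set M, graded_submodule Mg K -> K <> [set 0] ->
    graded_semi_essential_submodule Rg Mg K).

(* Main.v *)
(* If K is a nonzero graded submodule and P a nonzero graded prime submodule,
   write K = IM and P = JM. Then I is nonzero, and (P :_R M) is a graded prime
   ideal containing J, hence nonzero. So there is r <> 0 in I `&` (P :_R M), and
   rM is contained in K `&` P; it is nonzero because M is faithful. *)
Require Import Defs.
From mathcomp Require Import all_boot all_order all_algebra.
From mathcomp Require Import all_classical.

Set Implicit Arguments.
Unset Strict Implicit.
Unset Printing Implicit Defensive.

Import GRing.Theory.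

Local Open Scope classical_set_scope.
Local Open Scope ring_scope.

Lemma zmod_closed_set (V : zmodType) (A : set V) :
  zmod_closed (mem A) <-> A 0 /\ (forall x y, A x -> A y -> A (x - y)).
Proof.
split=> -[A0 AB]; split; [exact: set_mem A0 | | exact: mem_set A0 |] => x y Ax Ay.
  exact: (set_mem (AB x y (mem_set Ax) (mem_set Ay))).
exact: (mem_set (AB x y (set_mem Ax) (set_mem Ay))).
Qed.

Lemma submod_closed_set (R : pzRingType) (M : lmodType R) (N : set M) :
  submod_closed (mem N) <->
  N 0 /\ (forall a x y, N x -> N y -> N (a *: x + y)).
Proof.
split=> -[N0 NL]; split;
  [exact: set_mem N0 | | exact: mem_set N0 |] => a x y Nx Ny.
  exact: (set_mem (NL a x y (mem_set Nx) (mem_set Ny))).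
exact: (mem_set (NL a x y (set_mem Nx) (set_mem Ny))).
Qed.

Section SubmoduleClosure.
Variables (R : pzRingType) (M : lmodType R) (N : set M).
Hypothesis subN : submod_closed (mem N).

Lemma submod_set0 : N 0.
Proof. by have /submod_closed_set[] := subN. Qed.

Lemma submod_setD x y : N x -> N y -> N (x + y).
Proof.
by have /submod_closed_set[_ NL] := subN => Nx /(NL 1 _ _ Nx); rewrite scale1r.
Qed.

Lemma submod_setZ a x : N x -> N (a *: x).
Proof.
have /submod_closed_set[N0 NL] := subN.
by move=> Nx; have := NL a x 0 Nx N0; rewrite addr0.
Qed.

Lemma submod_setB x y : N x -> N y -> N (x - y).
Proof. by move=> Nx /(submod_setZ (-1)); rewrite scaleN1r; exact: submod_setD. Qed.

Lemma submod_fsum (I : choiceType) (A : set I) (c : I -> M) :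
  (forall i, N (c i)) -> N (\sum_(i \in A) c i).
Proof.
by move=> Nc; elim/big_ind: _ => //; [exact: submod_set0 | exact: submod_setD].
Qed.

End SubmoduleClosure.

Lemma zmod_fsum (V : zmodType) (A : set V) (I : choiceType) (B : set I)
    (c : I -> V) :
  zmod_closed (mem A) -> (forall i, A (c i)) -> A (\sum_(i \in B) c i).
Proof.
move=> /zmod_closed_set[A0 AB] Ac; elim/big_ind: _ => // x y Ax Ay.
(* Only closure under differences is given, so [x + y] is read as [x - (0 - y)]. *)
by rewrite -[y]opprK -(sub0r y); apply: (AB) => //; apply: AB.
Qed.

Lemma morph_fsum (V W : zmodType) (f : V -> W) (I : choiceType) (c : I -> V) :
  {morph f : x y / x + y} -> f 0 = 0 -> finite_set [set i | c i <> 0] ->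
  f (\sum_(i \in [set: I]) c i) = \sum_(i \in [set: I]) f (c i).
Proof.
move=> fD f0 fin_c.
(* Both sums are cut down to the support of [c]. As [f] may kill some terms, the support of [f \o c]
   can be smaller, but it lies inside this finite set. *)
rewrite -(@fsbig_widen _ _ _ _ [set i | c i <> 0]) //; last first.
  by move=> i [_ /contrapT].
rewrite -[RHS](@fsbig_widen _ _ _ _ [set i | c i <> 0]) //; last first.
  by move=> i [_ /contrapT] /= ->; rewrite f0.
by rewrite !fsbig_finite // (big_morph f fD f0).
Qed.

Lemma components_sub (G : choiceType) (V : zmodType) (A B : G -> set V) x c :
  (forall g, A g `<=` B g) -> components A x c -> components B x c.
Proof. by move=> AB [fin_c Ac ->]; split=> // g; exact: AB. Qed.

(* A subgroup is graded as soon as it contains the components of its elements: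
   uniqueness is inherited from the ambient grading. *)
Lemma direct_sum_sub (G : choiceType) (V : zmodType) (A : G -> set V)
    (N : set V) :
  direct_sum [set: V] A -> zmod_closed (mem N) ->
  (forall x c, N x -> components A x c -> forall g, N (c g)) ->
  direct_sum N (fun g => N `&` A g).
Proof.
move=> [existsA uniqA] subN Nc; split.
  apply/seteqP; split=> [x Nx | x [c [fin_c NAc ->]]].
    have : [set: V] x by [].
    rewrite existsA => -[c cx]; exists c; have [fin_c Ac xE] := cx.
    by split=> // g; split=> //; exact: Nc cx g.
  by apply: zmod_fsum => // g; case: (NAc g).
by move=> x c c' cx c'x; apply: uniqA; apply: components_sub;
  [| exact: cx | | exact: c'x] => g y [].
Qed.

Section Colon.
Variables (G : groupType) (R : pzRingType) (Rg : G -> set R).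
Variables (M : lmodType R) (Mg : G -> set M).
Hypotheses (grR : graded_ring Rg) (grM : graded_module Rg Mg).

(** Every element of [M] is a finite sum of homogeneous ones, and multiplication by [r] is
    additive. *)
Lemma submodule_homogeneous (N : set M) r : submod_closed (mem N) ->
  (forall m, homogeneous Mg m -> N (r *: m)) -> colon N r.
Proof.
move=> subN Nr m; have [_ [existsM _] _] := grM.
have : [set: M] m by [].
rewrite existsM => -[d [fin_d Md ->]].
rewrite (morph_fsum (scalerDr r) (scaler0 M r)) //; apply: submod_fsum => // h.
by apply: Nr; exists h.
Qed.

(** Multiplying by [m] of degree [h] moves degree [g] to [g * h]; right translation by [h] is a
    bijection of [G], so distinct components of [r] never merge. *)
Lemma components_scale r c h m : components Rg r c -> Mg h m ->
  components Mg (r *: m) (fun k => c (k * h^-1)%g *: m).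
Proof.
move=> [fin_c Rc ->] Mm; have [_ _ MgM] := grM; split.
- apply: (sub_finite_set _ (finite_image (fun g => (g * h)%g) fin_c)) => k /= ck.
  exists (k * h^-1)%g; last by rewrite mulgVK.
  by move=> c0; apply: ck; rewrite c0 scale0r.
- by move=> k; rewrite -{1}(mulgVK h k); exact: MgM.
- rewrite (morph_fsum (scalerDl m) (scale0r m)) //.
  apply: (@reindex_fsbigT _ _ _ _ _ (fun k => (k * h^-1)%g) (fun g => c g *: m)).
  by exists (fun k => (k * h)%g) => k; rewrite ?mulgK ?mulgVK.
Qed.

Lemma colon_ideal (N : set M) : submod_closed (mem N) -> ideal (colon N).
Proof.
move=> subN; split.
  apply/zmod_closed_set; split=> [m | a b Na Nb m].
    by rewrite scale0r; exact: submod_set0.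
  by rewrite scalerBl; exact: submod_setB.
move=> a r Nr; split=> m; rewrite -scalerA; last exact: Nr.
exact: submod_setZ.
Qed.

(** For homogeneous [m] of degree [h], [c g *: m] is the component of [r *: m] in degree [g * h],
    and a graded [N] contains the components of its elements. *)
Lemma colon_graded_ideal (N : set M) :
  graded_submodule Mg N -> graded_ideal Rg (colon N).
Proof.
move=> [subN [existsN _]]; have idN := colon_ideal subN.
have [_ dsR _] := grR; have [_ [_ uniqM] _] := grM.
split=> //; apply: direct_sum_sub => //; first by case: idN.
move=> r c Nr cr g; apply: submodule_homogeneous => // m [h _ Mm].
have := Nr m; rewrite {1}existsN => -[d dN].
(* The decomposition [d] inside [N] is also one in [M], so by uniqueness it is the translated
   family. *)
have /uniqM/(_ (components_scale cr Mm))/(_ (g * h)%g) :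
  components Mg (r *: m) d by apply: components_sub dN => k y [].
by rewrite mulgK => <-; case: dN => _ /(_ (g * h)%g)[].
Qed.

Lemma colon_graded_prime (P : set M) :
  graded_prime_submodule Rg Mg P -> graded_prime_ideal Rg (colon P).
Proof.
move=> [grP PT primeP]; have [subP _] := grP; split.
- exact: colon_graded_ideal.
- move=> PE; apply: PT; apply/seteqP; split=> // m _.
  have : colon P 1 by rewrite PE.
  by move/(_ m); rewrite scale1r.
(* If [a] is not in the colon, primeness of [P] applied to [a *: (b *: m)], with [b *: m]
   homogeneous, puts [b *: m] in [P]. *)
- move=> a b ha [g _ Rb] Pab; have [|nPa] := pselect (colon P a); first by left.
  right; apply: submodule_homogeneous => // m [h _ Mm].
  have [_ _ MgM] := grM.
  have /primeP : P (a *: (b *: m)) by rewrite scalerA; exact: Pab.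
  by case=> //; exists (g * h)%g => //; exact: MgM.
Qed.

End Colon.

Lemma ideal_smul_colon (R : pzRingType) (M : lmodType R) (I : set R) :
  I `<=` colon (@ideal_smul R M I).
Proof.
move=> r Ir m; exists 1, (fun=> r), (fun=> m); split=> //.
by rewrite big_ord1.
Qed.

Lemma ideal_smul0 (R : pzRingType) (M : lmodType R) :
  @ideal_smul R M [set 0] = [set 0].
Proof.
apply/seteqP; split=> [x [n [r [m [r0 ->]]]] | x ->] /=.
  by apply: big1 => i _; rewrite (r0 i) scale0r.
by exists 0, (fun=> 0), (fun=> 0); rewrite big_ord0.
Qed.

Lemma set1_0P (V : zmodType) (A : set V) : A 0 ->
  A <> [set 0] -> exists2 x, A x & x <> 0.
Proof.
move=> A0 nA; apply: contrapT => noA; apply: nA; apply/seteqP.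
split=> [x Ax | x -> //]; apply: contrapT => x0; apply: noA.
by exists x.
Qed.

Theorem proposition5p18 (G : groupType) (R : pzRingType) (Rg : G -> set R)
    (hR : graded_ring Rg) (hRu : graded_semi_uniform_ring Rg)
    (M : lmodType R) (Mg : G -> set M) (hM : graded_module Rg Mg)
    (hMm : graded_multiplication Rg Mg) (hMf : faithful M) :
  graded_semi_uniform_module Rg Mg.
Proof.
have ann0 r : (forall m : M, r *: m = 0) -> r = 0.
  by move=> rM; have : [set r : R | forall m : M, r *: m = 0] r by [];
    rewrite hMf.
have [R0 semiR] := hRu; split.
  (* On a zero module every [r] acts as 0, so faithfulness would make [R] zero. *)
  move=> M0; apply: R0; apply/seteqP; split=> // r _; apply: ann0 => m.
  by have : [set: M] (r *: m) by []; rewrite M0.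
move=> K grK K0; split=> // P primeP P0 KP0.
have [grP _ _] := primeP.
have [I [grI KE]] := hMm K grK; have [J [_ PE]] := hMm P grP.
have I0 : I <> [set 0] by move=> I0; apply: K0; rewrite KE I0 ideal_smul0.
have colonP0 : colon P <> [set 0].
  (* The coefficients of an element of [P = JM] lie in [J], hence in the colon; were it zero, [P]
     would vanish. *)
  move=> colonP0; apply: P0; apply/seteqP; split=> [x|x ->]; last first.
    by case: grP => /submod_set0.
  rewrite PE => -[n [r [m [Jr ->]]]]; apply: big1 => i _.
  have : colon P (r i) by rewrite PE; exact: ideal_smul_colon.
  by rewrite colonP0 => ->; rewrite scale0r.
have [_ _ essI] := semiR I grI I0.
have [|r [Ir Pr]] :=
    set1_0P _ (essI _ (colon_graded_prime hR hM primeP) colonP0).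
  split; first by case: grI => -[/zmod_closed_set[]].
  by case: grP => /colon_ideal[/zmod_closed_set[]].
(* Assuming [K] meets [P] trivially, the nonzero [r] would annihilate [M]. *)
apply; apply: ann0 => m.
have : (K `&` P) (r *: m) by split=> //; rewrite KE; exact: ideal_smul_colon.
by rewrite KP0.
Qed.
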